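(* Let $m,n\ge 2$. For every unitarily invariant norm $\|\cdot\|$ on $\mathbb{M}_n$ and all $A_1,\dots,A_m\in\mathbb{M}_n$, $$\Bigl\| \sum_{k=1}^m A_k \Bigr\|\ \le\ 2\,\Bigl\| \sum_{k=1}^m |A_k|_{\mathrm{sym}} \Bigr\|.$$ Moreover, the constant $2$ is sharp: if $c$ is a real number such that $\|\sum_{k=1}^m A_k\|\le c\,\|\sum_{k=1}^m|A_k|_{\mathrm{sym}}\|$ for every unitarily invariant norm on $\mathbb{M}_n$ and all $A_1,\dots,A_m\in\mathbb{M}_n$, then $c\ge 2$.
   Context: $\mathbb{M}_n$ is the set of $n\times n$ complex matrices, $Z^*$ is the conjugate transpose of $Z$, $|Z|:=(Z^*Z)^{1/2}$, and the arithmetic symmetric modulus is $|Z|_{\mathrm{sym}}:=\frac{|Z|+|Z^*|}{2}$. A norm $\|\cdot\|$ on $\mathbb{M}_n$ is unitarily invariant if $\|UZV\|=\|Z\|$ for all $Z\in\mathbb{M}_n$ and all unitaries $U,V\in\mathbb{M}_n$. *)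

(* Defs.v *)
From mathcomp Require Import all_boot all_order all_algebra.
From mathcomp Require Import reals complex.

Set Implicit Arguments.
Unset Strict Implicit.
Unset Printing Implicit Defensive.

Import Order.TTheory GRing.Theory Num.Theory.

Local Open Scope ring_scope.
Local Open Scope sesquilinear_scope.

(* Vectors are rows, so the quadratic form of A is v |-> v A v^*. *)
Definition psdmx (C : numClosedFieldType) (n : nat) (A : 'M[C]_n) : Prop :=
  A \is hermsymmx /\ forall v : 'rV[C]_n, 0 <= (v *m A *m v ^t*) 0 0.

(* Meaningful for positive semidefinite A only: by sqrtmxP and sqrtmx_uniq it
   is then the unique positive semidefinite square root of A. *)
Definition sqrtmx (C : numClosedFieldType) (n : nat) (A : 'M[C]_n) : 'M[C]_n :=
  (spectralmx A) ^t* *m diag_mx (map_mx sqrtC (spectral_diag A))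
    *m spectralmx A.

Definition modmx (C : numClosedFieldType) (n : nat) (Z : 'M[C]_n) : 'M[C]_n :=
  sqrtmx (Z ^t* *m Z).

Definition symmodmx (C : numClosedFieldType) (n : nat) (Z : 'M[C]_n) :
    'M[C]_n :=
  2^-1 *: (modmx Z + modmx (Z ^t*)).

Record mx_norm_axioms (R : realType) (n : nat) (N : 'M[R[i]]_n -> R) : Prop := {
  mxnorm_ge0 : forall Z, 0 <= N Z;
  mxnorm_eq0 : forall Z, N Z = 0 -> Z = 0;
  mxnormZ : forall (a : R[i]) Z, N (a *: Z) = Normc.normc a * N Z;
  mxnormD : forall Y Z, N (Y + Z) <= N Y + N Z
}.

Definition unitarily_invariant_norm (R : realType) (n : nat)
    (N : 'M[R[i]]_n -> R) : Prop :=
  mx_norm_axioms N /\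
  forall U Z V : 'M[R[i]]_n,
    U \is unitarymx -> V \is unitarymx -> N (U *m Z *m V) = N Z.

Lemma trCmxM (C : numClosedFieldType) m p q
    (A : 'M[C]_(m, p)) (B : 'M[C]_(p, q)) :
  (A *m B) ^t* = B ^t* *m A ^t*.
Proof. by rewrite trmx_mul map_mxM. Qed.

Lemma hermsymmxE (C : numClosedFieldType) n (A : 'M[C]_n) :
  (A \is hermsymmx) = (A == A ^t*).
Proof. by rewrite is_hermitianmxE expr0 scale1r. Qed.

Lemma diag_quad (C : numClosedFieldType) n (d w : 'rV[C]_n) :
  (w *m diag_mx d *m w ^t*) 0 0 = \sum_j d 0 j * `|w 0 j| ^+ 2.
Proof.
rewrite mxE; apply: eq_bigr => j _.
by rewrite mul_mx_diag !mxE normCK mulrAC mulrC.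
Qed.

Lemma psdmx_diag (C : numClosedFieldType) n (U : 'M[C]_n) (d : 'rV[C]_n) :
  (forall j, 0 <= d 0 j) -> psdmx (U ^t* *m diag_mx d *m U).
Proof.
move=> d_ge0; split.
  rewrite hermsymmxE !trCmxM trmxCK mulmxA tr_diag_mx map_diag_mx.
  apply/eqP; congr (_ *m diag_mx _ *m _); apply/rowP => j.
  by rewrite mxE; apply/esym/CrealP/ger0_real.
move=> v; rewrite !mulmxA -mulmxA.
have -> : U *m v ^t* = (v *m U ^t*) ^t* by rewrite trCmxM trmxCK.
by rewrite diag_quad; apply: sumr_ge0 => j _; rewrite mulr_ge0 ?exprn_ge0.
Qed.

Lemma psdmx_gram (C : numClosedFieldType) n (Z : 'M[C]_n) : psdmx (Z ^t* *m Z).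
Proof.
have := @psdmx_diag C n Z (const_mx 1).
by rewrite diag_const_mx mulmx1; apply=> j; rewrite mxE ler01.
Qed.

Lemma psdmx_spectral (C : numClosedFieldType) n (A : 'M[C]_n) :
  psdmx A ->
  A = (spectralmx A) ^t* *m diag_mx (spectral_diag A) *m spectralmx A
  /\ forall j, 0 <= spectral_diag A 0 j.
Proof.
move=> [hA qA]; have /hermitian_normalmx /orthomx_spectralP := hA.
rewrite invmx_unitary ?spectral_unitarymx //.
have := spectral_unitarymx A.
move: (spectralmx A) (spectral_diag A) => U d Uu eA; split=> // j.
have := qA (delta_mx 0 j *m U).
rewrite eA !mulmxA mulmxtVK // trCmxM !mulmxA mulmxtVK // diag_quad.
rewrite (bigD1 j) //= big1 => [|k /negbTE kj]; last first.
  by rewrite mxE kj andbF normr0 expr0n mulr0.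
by rewrite !mxE !eqxx normr1 expr1n mulr1 addr0.
Qed.

Lemma sqrtmxP (C : numClosedFieldType) n (A : 'M[C]_n) :
  psdmx A -> psdmx (sqrtmx A) /\ sqrtmx A *m sqrtmx A = A.
Proof.
move=> /psdmx_spectral [eA dA]; split.
  by apply: psdmx_diag => j; rewrite mxE sqrtC_ge0.
rewrite [in RHS]eA /sqrtmx !mulmxA mulmxtVK ?spectral_unitarymx //.
rewrite -[_ *m diag_mx _ *m diag_mx _]mulmxA mulmx_diag.
congr (_ *m diag_mx _ *m _); apply/rowP => j.
by rewrite !mxE -expr2 sqrtCK.
Qed.

Lemma sqrtmx_uniq (C : numClosedFieldType) n (A B : 'M[C]_n) :
  psdmx A -> psdmx B -> B *m B = A -> B = sqrtmx A.
Proof.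
move=> pA pB eBA; have [pS eS] := sqrtmxP pA.
move: (sqrtmx A) pS eS => S pS eS {pA}.
have [eB dB] := psdmx_spectral pB; have [eS' dS] := psdmx_spectral pS.
have Uu := spectral_unitarymx B; have Vu := spectral_unitarymx S.
move: (spectralmx B) (spectral_diag B) Uu eB dB => U d Uu eB dB.
move: (spectralmx S) (spectral_diag S) Vu eS' dS => V e Vu eS' dS.
have [W eW] : exists W, W = U *m V ^t* by exists (U *m V ^t*).
have UB : U *m B = diag_mx d *m U.
  by rewrite eB !mulmxA (unitarymxP Uu) mul1mx.
have SV : S *m V ^t* = V ^t* *m diag_mx e.
  by rewrite eS' mulmxtVK.
have W2 : diag_mx d *m diag_mx d *m W = W *m diag_mx e *m diag_mx e.
  rewrite eW !mulmxA -[diag_mx d *m _ *m U]mulmxA -UB !mulmxA -UB.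
  rewrite -[_ *m V ^t* *m _]mulmxA -SV -!mulmxA -SV !mulmxA.
  by rewrite -[U *m B *m B]mulmxA eBA -eS !mulmxA.
have W1 : diag_mx d *m W = W *m diag_mx e.
  apply/matrixP => i j; have /matrixP/(_ i j) := W2.
  rewrite mulmx_diag mul_diag_mx -[W *m _ *m _]mulmxA mulmx_diag.
  rewrite !mul_mx_diag mul_diag_mx !mxE.
  have [->|w0] := eqVneq (W i j) 0; first by rewrite !mulr0 !mul0r.
  rewrite [W i j * (_ * _)]mulrC => /(mulIf w0) /eqP.
  by rewrite -!expr2 eqrXn2 // => /eqP ->; rewrite mulrC.
have UV : U ^t* *m W = V ^t*.
  rewrite eW mulmxA -(invmx_unitary Uu) mulVmx ?mul1mx //.
  exact: unitarymx_unit.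
have WV : W *m V = U.
  rewrite eW -mulmxA -(invmx_unitary Vu) mulVmx ?mulmx1 //.
  exact: unitarymx_unit.
by rewrite eB eS' -[X in _ *m X = _]WV !mulmxA -[_ *m diag_mx d *m W]mulmxA W1 mulmxA UV.
Qed.

(* Main.v *)
Require Import Defs.
From mathcomp Require Import all_boot all_order all_algebra.
From mathcomp Require Import classical_sets reals complex.
From mathcomp Require Import lra.

(** Upper bound.  Every A satisfies the block inequality
    [[ |A^*|, A ], [ A^*, |A| ]] >= 0 ([psdmx_block_modmx]), because for the
    Hermitian dilation H = [[ 0, A ], [ A^*, 0 ]] one has |H| + H >= 0 and |H|
    is the block diagonal matrix of |A^*| and |A|.  Summing over k, the matrix
    [[ P, S ], [ S^*, Q ]] is positive semidefinite, with S the sum of the A_k,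
    P that of the |A_k^*| and Q that of the |A_k|.  If S = U|S| is a polar
    decomposition, compressing this block matrix by (-U^*, 1) gives
    2|S| <= U^* P U + Q.  A unitarily invariant norm N is monotone on positive
    semidefinite matrices ([norm_mono]), so 2 N(S) <= N(P) + N(Q)
    ([norm_offdiag]); and N(P), N(Q) <= N(P + Q), again by monotonicity.  Hence
    N(S) <= N(P + Q), and P + Q is twice the sum of the symmetric moduli.

    Monotonicity.  If 0 <= X <= Y with Y invertible, then
    D = Y^{-1/2} X Y^{-1/2} satisfies 0 <= D <= 1, and X = Z^* Z for
    Z = D^{1/2} Y^{1/2}.  The matrices Z^* Z and Z Z^* = D^{1/2} Y D^{1/2} are
    unitarily equivalent, and D^{1/2} is the average of two unitary matrices
    ([sqrtmx_contraction]), so multiplying by it does not increase N.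

    The polar decompositions and the inverse of Y are taken for invertible
    matrices only; the general case follows by adding small scalar matrices and
    letting them tend to 0.

    Sharpness.  For a <> b let A_1 be the matrix unit E_ab and let the other
    A_k vanish.  Then |A_1| = E_bb and |A_1^*| = E_aa, and for the operator norm
    E_ab and E_aa + E_bb both have norm 1, so that 1 <= c / 2. *)

Import Order.TTheory GRing.Theory Num.Theory.

Local Open Scope ring_scope.
Local Open Scope sesquilinear_scope.

(** * Conjugate transposes *)

Section Adjoint.
Set Implicit Arguments.
Unset Strict Implicit.
Variable C : numClosedFieldType.

Lemma trCmxD p q (A B : 'M[C]_(p, q)) : (A + B) ^t* = A ^t* + B ^t*.
Proof. by apply/matrixP => i j; rewrite !mxE rmorphD. Qed.

Lemma trCmxZ p q (a : C) (A : 'M[C]_(p, q)) : (a *: A) ^t* = a^* *: A ^t*.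
Proof. by apply/matrixP => i j; rewrite !mxE rmorphM. Qed.

Lemma trCmxN p q (A : 'M[C]_(p, q)) : (- A) ^t* = - A ^t*.
Proof. by rewrite -scaleN1r trCmxZ rmorphN1 scaleN1r. Qed.

Lemma trCmx0 p q : (0 : 'M[C]_(p, q)) ^t* = 0.
Proof. by apply/matrixP => i j; rewrite !mxE rmorph0. Qed.

Lemma trCmx1 n : (1%:M : 'M[C]_n) ^t* = 1%:M.
Proof. by apply/matrixP => i j; rewrite !mxE rmorph_nat eq_sym. Qed.

Lemma trCmx_delta p q (i : 'I_p) (j : 'I_q) :
  (delta_mx i j : 'M[C]_(p, q)) ^t* = delta_mx j i.
Proof. by apply/matrixP => k l; rewrite !mxE rmorph_nat andbC. Qed.

Lemma trCmx_block p q r s (A : 'M[C]_(p, r)) B D (E : 'M[C]_(q, s)) :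
  (block_mx A B D E) ^t* = block_mx (A ^t*) (D ^t*) (B ^t*) (E ^t*).
Proof. by rewrite tr_block_mx map_block_mx. Qed.

Lemma trCmx_row_mx p q r (A : 'M[C]_(p, q)) (B : 'M[C]_(p, r)) :
  (row_mx A B) ^t* = col_mx (A ^t*) (B ^t*).
Proof. by rewrite tr_row_mx map_col_mx. Qed.

Lemma trCmx_inv n (A : 'M[C]_n) : (invmx A) ^t* = invmx (A ^t*).
Proof. by rewrite trmx_inv map_invmx. Qed.

Lemma trCmx_unit n (A : 'M[C]_n) : (A ^t* \in unitmx) = (A \in unitmx).
Proof. by rewrite map_unitmx unitmx_tr. Qed.

Lemma unitarymx_trCl n (U : 'M[C]_n) : U \is unitarymx -> U ^t* *m U = 1%:M.
Proof. by rewrite -trmxC_unitary => /unitarymxP; rewrite trmxCK. Qed.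

Lemma half_add_half : 2^-1 + 2^-1 = 1 :> C.
Proof. by rewrite -mulr2n -[LHS]mulr_natl divff ?pnatr_eq0. Qed.

Lemma unitarymx1 n : (1%:M : 'M[C]_n) \is unitarymx.
Proof. by apply/unitarymxP; rewrite trCmx1 mulmx1. Qed.
End Adjoint.

(** * Positive semidefinite matrices and the modulus *)

Section Loewner.
Set Implicit Arguments.
Unset Strict Implicit.
Variable C : numClosedFieldType.
Implicit Types n : nat.

Lemma psdmx_herm n (A : 'M[C]_n) : psdmx A -> A ^t* = A.
Proof. by case; rewrite hermsymmxE => /eqP <-. Qed.

Lemma psdmx_congr p n (M : 'M[C]_(p, n)) (A : 'M[C]_n) :
  psdmx A -> psdmx (M *m A *m M ^t*).
Proof.
move=> pA; split.
  by rewrite hermsymmxE !trCmxM trmxCK (psdmx_herm pA) mulmxA.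
by move=> v; case: pA => _ /(_ (v *m M)); rewrite trCmxM !mulmxA.
Qed.

Lemma psdmxD n (A B : 'M[C]_n) : psdmx A -> psdmx B -> psdmx (A + B).
Proof.
move=> pA pB; split.
  by rewrite hermsymmxE trCmxD !psdmx_herm.
by move=> v; rewrite mulmxDr mulmxDl mxE addr_ge0 //; [case: pA|case: pB].
Qed.

Lemma psdmxZ n (a : C) (A : 'M[C]_n) : 0 <= a -> psdmx A -> psdmx (a *: A).
Proof.
move=> a0 pA; split.
  by rewrite hermsymmxE trCmxZ (psdmx_herm pA) (CrealP (ger0_real a0)).
by move=> v; rewrite -scalemxAr -scalemxAl mxE mulr_ge0 //; case: pA.
Qed.

Lemma psdmx0 n : psdmx (0 : 'M[C]_n).
Proof.
split; first by rewrite hermsymmxE trCmx0.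
by move=> v; rewrite mulmx0 mul0mx mxE.
Qed.

Lemma psdmx_sum n (I : Type) (r : seq I) (F : I -> 'M[C]_n) :
  (forall i, psdmx (F i)) -> psdmx (\sum_(i <- r) F i).
Proof.
by move=> pF; apply: big_ind => //; [exact: psdmx0|exact: psdmxD].
Qed.

Lemma psdmx1 n : psdmx (1%:M : 'M[C]_n).
Proof. by have := psdmx_gram (1%:M : 'M[C]_n); rewrite trCmx1 mulmx1. Qed.

Lemma psdmx_modmx n (A : 'M[C]_n) : psdmx (modmx A).
Proof. by have [] := sqrtmxP (psdmx_gram A). Qed.

Lemma modmx_sqr n (A : 'M[C]_n) : modmx A *m modmx A = A ^t* *m A.
Proof. by have [] := sqrtmxP (psdmx_gram A). Qed.

Lemma modmx_uniq n (A B : 'M[C]_n) :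
  psdmx B -> B *m B = A ^t* *m A -> modmx A = B.
Proof. by move=> pB eB; apply/esym/sqrtmx_uniq => //; apply: psdmx_gram. Qed.

Lemma psdmx_block_diag p q (A : 'M[C]_p) (B : 'M[C]_q) :
  psdmx A -> psdmx B -> psdmx (block_mx A 0 0 B).
Proof.
move=> pA pB; split.
  by rewrite hermsymmxE trCmx_block !trCmx0 !psdmx_herm.
move=> v; rewrite -[v]hsubmxK trCmx_row_mx mul_row_block !mulmx0 addr0 add0r.
by rewrite mul_row_col mxE addr_ge0 //; [case: pA|case: pB].
Qed.

Lemma psdmx_block_same n (A : 'M[C]_n) : psdmx A -> psdmx (block_mx A A A A).
Proof.
move=> /(psdmx_congr ((row_mx 1%:M 1%:M) ^t*)); rewrite trmxCK trCmx_row_mx.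
by rewrite trCmx1 mul_col_mx !mul1mx mul_col_row !mulmx1.
Qed.

(** In an orthonormal eigenbasis |H| + H is diagonal with entries |d| + d,
    where d is real. *)
Lemma psdmx_modmxD n (H : 'M[C]_n) : H ^t* = H -> psdmx (modmx H + H).
Proof.
move=> hH; have Hh : H \is hermsymmx by rewrite hermsymmxE hH.
have /mxOverP dR := hermitian_spectral_diag_real Hh.
have /orthomx_spectralP := hermitian_normalmx Hh.
have Uu := spectral_unitarymx H; rewrite invmx_unitary //.
move: (spectralmx H) (spectral_diag H) Uu dR => U d Uu dR eH.
have eA : modmx H = U ^t* *m diag_mx (map_mx Num.norm d) *m U.
  apply: modmx_uniq; first by apply: psdmx_diag => j; rewrite mxE.
  rewrite hH eH !mulmxA !mulmxtVK //.
  rewrite -[_ *m diag_mx _ *m diag_mx _]mulmxA.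
  rewrite -[_ *m diag_mx d *m diag_mx d]mulmxA !mulmx_diag.
  congr (_ *m diag_mx _ *m _); apply/rowP => j.
  by rewrite !mxE -!expr2 real_normK.
rewrite eA eH -mulmxDl -mulmxDr -raddfD; apply: psdmx_diag => j.
rewrite !mxE -[X in _ + X]opprK subr_ge0.
by apply: le_trans (real_ler_norm _) _; rewrite ?rpredN // normrN.
Qed.

(** This is |H| + H >= 0 for the Hermitian dilation H of A: the square of H is
    block diagonal with blocks A A^* and A^* A, which identifies |H|. *)
Lemma psdmx_block_modmx n (A : 'M[C]_n) :
  psdmx (block_mx (modmx (A ^t*)) A (A ^t*) (modmx A)).
Proof.
pose H := block_mx 0 A (A ^t*) 0 : 'M[C]_(n + n).
have hH : H ^t* = H by rewrite trCmx_block !trCmx0 trmxCK.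
have /psdmx_modmxD := hH.
rewrite (_ : modmx H = block_mx (modmx (A ^t*)) 0 0 (modmx A)).
  by rewrite add_block_mx !addr0 !add0r.
apply: modmx_uniq; first by apply: psdmx_block_diag; apply: psdmx_modmx.
rewrite hH !mulmx_block !mulmx0 !mul0mx !addr0 !add0r !modmx_sqr.
by rewrite trmxCK.
Qed.

(** The Loewner inequality U^* S + S^* U <= U^* P U + Q, obtained by compressing
    the block matrix by the row (-U^*, 1).  When U is the unitary factor of S,
    its left-hand side is 2|S|. *)
Lemma psdmx_block_le n (P S Q : 'M[C]_n) :
  psdmx (block_mx P S (S ^t*) Q) ->
  forall U, psdmx (U ^t* *m P *m U + Q - (U ^t* *m S + S ^t* *m U)).
Proof.
move=> pB U; have := psdmx_congr (row_mx (- U ^t*) 1%:M) pB.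
rewrite trCmx_row_mx trCmxN trmxCK trCmx1 mul_row_block mul_row_col.
rewrite !mul1mx mulmx1 !mulmxDl !mulNmx !mulmxN opprK.
by rewrite opprD [- _ + Q]addrC addrACA [- (S ^t* *m U) - _]addrC.
Qed.

Lemma modmx_unit n (Z : 'M[C]_n) : (modmx Z \in unitmx) = (Z \in unitmx).
Proof.
have := congr1 (fun M => M \in unitmx) (modmx_sqr Z).
by move: (modmx Z) => M; rewrite /= !unitmx_mul trCmx_unit !andbb.
Qed.

Lemma polar_unit n (Z : 'M[C]_n) :
  Z \in unitmx -> exists2 U, U \is unitarymx & Z = U *m modmx Z.
Proof.
move=> uZ; have uM : modmx Z \in unitmx by rewrite modmx_unit.
exists (Z *m invmx (modmx Z)); last by rewrite mulmxKV.
rewrite -trmxC_unitary; apply/unitarymxP; rewrite trmxCK trCmxM trCmx_inv.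
rewrite (psdmx_herm (psdmx_modmx Z)) !mulmxA -[_ *m Z ^t* *m Z]mulmxA.
by rewrite -modmx_sqr mulmxA mulVmx // mul1mx mulmxV.
Qed.

Lemma psdmx_unitD n (A : 'M[C]_n) (t : C) :
  psdmx A -> 0 < t -> A + t%:M \in unitmx.
Proof.
move=> pA t0; rewrite -row_free_unit; apply: inj_row_free => v v0.
have := congr1 (fun w => (w *m v ^t*) 0 0) v0; rewrite mul0mx [RHS]mxE.
rewrite mulmxDr mulmxDl mxE mul_mx_scalar -scalemxAl => /eqP.
have qA : 0 <= (v *m A *m v ^t*) 0 0 by case: pA.
have e : (v *m v ^t*) 0 0 = \sum_j `|v 0 j| ^+ 2.
  by rewrite mxE; apply: eq_bigr => j _; rewrite !mxE normCK.
have q1 : 0 <= (v *m v ^t*) 0 0 by rewrite e sumr_ge0 // => j _; rewrite exprn_ge0.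
rewrite [X in _ + X]mxE paddr_eq0 ?(mulr_ge0 (ltW t0)) // => /andP[_].
rewrite mulf_eq0 (gt_eqF t0) /=.
rewrite e psumr_eq0; last by move=> j _; rewrite exprn_ge0.
move=> /allP h; apply/rowP => j; rewrite mxE.
by have := h j (mem_index_enum _); rewrite expf_eq0 /= normr_eq0 => /eqP.
Qed.

(** Invertible matrices are dense, in the form needed below: the n + 1 distinct
    values -e/(k + 1) cannot all be among the at most n roots of the
    characteristic polynomial. *)
Lemma exists_unitD n (A : 'M[C]_n) (e : C) :
  0 < e -> exists2 t, 0 < t <= e & A + t%:M \in unitmx.
Proof.
move=> e0; pose rs := [seq - (e / k.+1%:R) | k <- iota 0 n.+1].
have urs : uniq rs.
  rewrite map_inj_uniq ?iota_uniq // => i j /oppr_inj /(mulfI (lt0r_neq0 e0)).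
  by move=> /invr_inj /eqP; rewrite eqr_nat => /eqP [].
have /allPn [_ /mapP [k _ ->] nr] : ~~ all (root (char_poly A)) rs.
  apply/negP => h; have p0 : char_poly A != 0 by rewrite monic_neq0 ?char_poly_monic.
  have := max_poly_roots p0 h urs.
  by rewrite size_char_poly size_map size_iota ltnn.
exists (e / k.+1%:R).
  by rewrite divr_gt0 ?ltr0n //= ler_piMr ?invf_le1 ?ltr0n ?ler1n // ltW.
move: nr; rewrite -eigenvalue_root_char; apply: contraR.
rewrite /eigenvalue /eigenspace kermx_eq0 row_free_unit raddfN /=.
by rewrite opprK.
Qed.

Lemma psdmx_diag_ge0 n (A : 'M[C]_n) (j : 'I_n) : psdmx A -> 0 <= A j j.
Proof.
case=> _ /(_ (delta_mx 0 j)).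
by rewrite trCmx_delta -rowE -colE !mxE.
Qed.

(** For 0 <= d <= 1 the number z = sqrt d + i sqrt (1 - d) has modulus 1 and
    sqrt d is the average of z and its conjugate.  Applied to the eigenvalues of
    D, this writes the square root of D as the average of two unitaries. *)
Lemma sqrtmx_contraction n (D : 'M[C]_n) : psdmx D -> psdmx (1%:M - D) ->
  exists2 U, U \is unitarymx & sqrtmx D = 2^-1 *: (U + U ^t*).
Proof.
move=> /psdmx_spectral [eD d0] /(psdmx_congr (spectralmx D)).
have := spectral_unitarymx D.
rewrite /sqrtmx [X in _ - X]eD; move: (spectralmx D) (spectral_diag D) d0.
move=> V d d0 Vu; rewrite mulmxBr mulmxBl mulmx1 !mulmxA !mulmxtVK //.
rewrite !(unitarymxP Vu) mul1mx => p1.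
have d1 j : 0 <= 1 - d 0 j.
  by have := psdmx_diag_ge0 j p1; rewrite !mxE eqxx mulr1n.
pose z := map_mx (fun x => sqrtC x + 'i * sqrtC (1 - x)) d.
have zC j : (sqrtC (d 0 j) + 'i * sqrtC (1 - d 0 j))^* =
    sqrtC (d 0 j) - 'i * sqrtC (1 - d 0 j).
  rewrite rmorphD rmorphM /= conjCi.
  by rewrite !(CrealP _) ?mulNr // ger0_real // sqrtC_ge0.
have eU : (V ^t* *m diag_mx z *m V) ^t* =
    V ^t* *m diag_mx (map_mx Num.conj z) *m V.
  by rewrite !trCmxM trmxCK tr_diag_mx map_diag_mx mulmxA.
exists (V ^t* *m diag_mx z *m V).
  apply/unitarymxP; rewrite eU !mulmxA mulmxtVK //.
  rewrite -[_ *m diag_mx z *m _]mulmxA mulmx_diag.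
  rewrite (_ : \row_j _ = const_mx 1).
    by rewrite diag_const_mx mulmx1 unitarymx_trCl.
  apply/rowP => j; rewrite !mxE zC.
  by rewrite [LHS]mulrC -subr_sqr exprMn sqrCi !sqrtCK mulN1r opprK addrC subrK.
rewrite eU -mulmxDl -mulmxDr -raddfD scalemxAl scalemxAr -linearZ.
congr (_ *m diag_mx _ *m _); apply/rowP => j.
rewrite !mxE zC.
rewrite addrACA subrr addr0 -mulr2n -[X in _ * X]mulr_natl.
by rewrite mulKf // pnatr_eq0.
Qed.
End Loewner.

(** * Monotonicity of unitarily invariant norms *)

Section UnitarilyInvariantNorm.
Set Implicit Arguments.
Unset Strict Implicit.
Variables (R : realType) (n : nat) (N : 'M[R[i]]_n -> R).
Hypothesis hN : unitarily_invariant_norm N.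
Implicit Types A B X Y Z : 'M[R[i]]_n.

Let Nax : mx_norm_axioms N. Proof. by case: hN. Qed.

Lemma normc_ge0E (x : R[i]) : 0 <= x -> (Normc.normc x)%:C%C = x.
Proof. by move=> x0; rewrite -[RHS]ger0_norm. Qed.

Lemma normUl U Z : U \is unitarymx -> N (U *m Z) = N Z.
Proof.
by case: hN => _ h Uu; rewrite -[U *m Z]mulmx1 (h _ _ _ Uu (unitarymx1 _ n)).
Qed.

Lemma normUr Z U : U \is unitarymx -> N (Z *m U) = N Z.
Proof.
by case: hN => _ h Uu; rewrite -[Z in LHS]mul1mx (h _ _ _ (unitarymx1 _ n) Uu).
Qed.

Lemma normN Z : N (- Z) = N Z.
Proof.
by rewrite -scaleN1r (mxnormZ Nax) normcN Normc.normc1 mul1r.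
Qed.

Lemma norm_double Z : N (Z + Z) = 2 * N Z.
Proof.
rewrite -mulr2n -scaler_nat (mxnormZ Nax); congr (_ * _).
by apply: complexI; rewrite normc_ge0E ?ler0n // rmorph_nat.
Qed.

Lemma norm_average Y Z : N Y <= N Z -> N (2^-1 *: (Y + Z)) <= N Z.
Proof.
move=> YZ; rewrite (mxnormZ Nax) Normc.normcV.
have -> : Normc.normc (2 : R[i]) = 2.
  by apply: complexI; rewrite normc_ge0E ?ler0n // rmorph_nat.
rewrite mulrC ler_pdivrMr ?ltr0n // mulr_natr mulr2n.
by apply: le_trans (mxnormD Nax _ _) _; rewrite lerD2r.
Qed.

Lemma norm_scalar (t : R[i]) (e : R) : 0 <= t <= e%:C%C -> N t%:M <= e * N 1%:M.
Proof.
case/andP=> t0 te; rewrite -[t%:M]scalemx1 (mxnormZ Nax).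
apply: ler_wpM2r; rewrite ?(mxnorm_ge0 Nax) //.
by rewrite -lecR normc_ge0E.
Qed.

(** With the polar decomposition Z = U M, the two matrices are M M and
    U (M M) U^*. *)
Lemma norm_gram_unit Z : Z \in unitmx -> N (Z ^t* *m Z) = N (Z *m Z ^t*).
Proof.
move=> /polar_unit [U Uu eZ]; rewrite eZ trCmxM (psdmx_herm (psdmx_modmx Z)).
have Uu' : U ^t* \is unitarymx by rewrite trmxC_unitary.
move: (modmx Z) => M; rewrite -[in RHS]mulmxA (normUl _ Uu) [in RHS]mulmxA.
by rewrite (normUr _ Uu') !mulmxA (mulmxKtV _ Uu (erefl n)).
Qed.

Lemma norm_modmx_unit Z : Z \in unitmx -> N (modmx Z) = N Z.
Proof. by move=> /polar_unit [U Uu {2}->]; rewrite (normUl _ Uu). Qed.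

Lemma norm_sqrt_contraction D Y : psdmx D -> psdmx (1%:M - D) ->
  N (sqrtmx D *m Y *m sqrtmx D) <= N Y.
Proof.
move=> pD p1; have [U Uu ->] := sqrtmx_contraction pD p1.
have Uu' : U ^t* \is unitarymx by rewrite trmxC_unitary.
set K := 2^-1 *: _; apply: (@le_trans _ _ (N (K *m Y))).
  rewrite -scalemxAr mulmxDr -(normUr (K *m Y) Uu').
  by apply: norm_average; rewrite (normUr _ Uu) (normUr _ Uu').
rewrite -scalemxAl mulmxDl -(normUl Y Uu').
by apply: norm_average; rewrite (normUl _ Uu) (normUl _ Uu').
Qed.

(** The witness is X = Z^* Z with Z = D^{1/2} Y^{1/2} and
    D = Y^{-1/2} X Y^{-1/2}, a positive semidefinite contraction; swapping the
    factors of Z^* Z leaves D^{1/2} Y D^{1/2}, to which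
    [norm_sqrt_contraction] applies. *)
Lemma norm_mono_unit X Y : X \in unitmx -> Y \in unitmx ->
  psdmx X -> psdmx Y -> psdmx (Y - X) -> N X <= N Y.
Proof.
move=> uX uY pX pY pYX; have [pS eS] := sqrtmxP pY.
move: (sqrtmx Y) pS eS => S pS eS.
have uS : S \in unitmx by move: uY; rewrite -eS unitmx_mul => /andP[].
have hV : (invmx S) ^t* = invmx S by rewrite trCmx_inv psdmx_herm.
pose D := invmx S *m X *m invmx S.
have pD : psdmx D by have := psdmx_congr (invmx S) pX; rewrite hV.
have p1 : psdmx (1%:M - D).
  have := psdmx_congr (invmx S) pYX; rewrite hV mulmxBr mulmxBl -/D.
  by rewrite -[in _ *m Y]eS mulmxA (mulVmx uS) mul1mx (mulmxV uS).
have [pK eK] := sqrtmxP pD.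
have := norm_sqrt_contraction Y pD p1.
move: (sqrtmx D) pK eK => K pK eK; apply: le_trans.
have eX : X = (K *m S) ^t* *m (K *m S).
  rewrite trCmxM (psdmx_herm pK) (psdmx_herm pS) -mulmxA [K *m _]mulmxA eK.
  by rewrite !mulmxA (mulmxV uS) mul1mx mulmxKV.
have uKS : K *m S \in unitmx.
  by move: uX; rewrite eX unitmx_mul => /andP[].
rewrite eX (norm_gram_unit uKS) trCmxM (psdmx_herm pK) (psdmx_herm pS) -eS.
by rewrite !mulmxA.
Qed.

Lemma le_addMeps (a b c : R) : (forall e, 0 < e -> a <= b + e * c) -> a <= b.
Proof.
move=> h; apply/ler_addgt0Pr => e e0.
have c1 : 0 < 1 + `|c| by rewrite ltr_pwDl.
apply: le_trans (h (e / (1 + `|c|)) _) _; first by rewrite divr_gt0.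
rewrite lerD2l -mulrA ler_piMr ?(ltW e0) // mulrC ler_pdivrMr // mul1r.
by apply: le_trans (ler_norm c) _; rewrite lerDr.
Qed.

(** Adding e to both matrices makes them invertible without changing their
    difference, and costs at most e N(1) in each norm. *)
Lemma norm_mono X Y : psdmx X -> psdmx (Y - X) -> N X <= N Y.
Proof.
move=> pX pYX; have pY : psdmx Y by have := psdmxD pX pYX; rewrite addrC subrK.
apply: (@le_addMeps _ _ (2 * N 1%:M)) => e e0.
have ec : 0 < e%:C%C by rewrite ltcR.
have pe : psdmx (e%:C%C%:M : 'M[R[i]]_n).
  by rewrite -scalemx1; apply: psdmxZ (ltW ec) (psdmx1 _ _).
have NE : N (e%:C%C)%:M <= e * N 1%:M by apply: norm_scalar; rewrite lexx ltW.
have -> : X = X + (e%:C%C)%:M - (e%:C%C)%:M by rewrite addrK.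
apply: le_trans (mxnormD Nax _ _) _; rewrite normN.
rewrite mulrCA mulr_natl mulr2n addrA lerD //.
apply: le_trans (lerD (lexx _) NE); apply: le_trans (mxnormD Nax _ _).
apply: norm_mono_unit.
- exact: psdmx_unitD.
- exact: psdmx_unitD.
- exact: psdmxD.
- exact: psdmxD.
suff -> : Y + (e%:C%C)%:M - (X + (e%:C%C)%:M) = Y - X by [].
by rewrite opprD addrACA [X in _ + X]subrr addr0.
Qed.

(** * Norms of off-diagonal blocks *)

(** With S = U|S|, the compression inequality reads 2|S| <= U^* P U + Q. *)
Lemma norm_offdiag_unit (P S Q : 'M[R[i]]_n) : S \in unitmx ->
  psdmx (block_mx P S (S ^t*) Q) -> 2 * N S <= N P + N Q.
Proof.
move=> uS; have [U Uu eS] := polar_unit uS.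
move=> /psdmx_block_le /(_ U).
have UM : U ^t* *m S = modmx S by rewrite {1}eS mulmxA unitarymx_trCl ?mul1mx.
have -> : S ^t* *m U = modmx S.
  by rewrite -[LHS]trmxCK trCmxM trmxCK UM psdmx_herm //; apply: psdmx_modmx.
rewrite UM => p; have := norm_mono _ p.
rewrite norm_double norm_modmx_unit // => h.
apply: le_trans (h _) _; first by apply: psdmxD; apply: psdmx_modmx.
apply: le_trans (mxnormD Nax _ _) _.
by rewrite (normUr _ Uu) normUl ?trmxC_unitary.
Qed.

(** Adding t >= 0 to all four blocks preserves positivity, and S + t is
    invertible for arbitrarily small t. *)
Lemma norm_offdiag (P S Q : 'M[R[i]]_n) :
  psdmx (block_mx P S (S ^t*) Q) -> 2 * N S <= N P + N Q.
Proof.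
move=> pB; apply: (@le_addMeps _ _ (4 * N 1%:M)) => e e0.
have ec : 0 < e%:C%C by rewrite ltcR.
have [t /andP[t0 te] uS] := exists_unitD S ec.
have NT : N t%:M <= e * N 1%:M by apply: norm_scalar; rewrite te ltW.
have tr : t ^* = t by apply/CrealP/ger0_real/ltW.
have p1 : psdmx (block_mx t%:M t%:M t%:M t%:M : 'M[R[i]]_(n + n)).
  have pt : psdmx (t%:M : 'M[R[i]]_n).
    by rewrite -scalemx1; apply: psdmxZ (ltW t0) (psdmx1 _ _).
  exact: psdmx_block_same.
have : 2 * N (S + t%:M) <= N (P + t%:M) + N (Q + t%:M).
  apply: (norm_offdiag_unit uS).
  have -> : (S + t%:M) ^t* = S ^t* + t%:M.
    by rewrite trCmxD -[in (t%:M)^t*]scalemx1 trCmxZ tr trCmx1 scalemx1.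
  by have := psdmxD pB p1; rewrite add_block_mx.
have hP := mxnormD Nax P t%:M; have hQ := mxnormD Nax Q t%:M.
have := mxnormD Nax (S + t%:M) (- t%:M); rewrite addrK normN.
move: NT hP hQ; move: (N t%:M) => Nt NT hP hQ hS hPQ.
lra.
Qed.

Lemma norm_offdiag_le_add (P S Q : 'M[R[i]]_n) : psdmx P -> psdmx Q ->
  psdmx (block_mx P S (S ^t*) Q) -> N S <= N (P + Q).
Proof.
move=> pP pQ /norm_offdiag h.
have hP : N P <= N (P + Q) by apply: (norm_mono pP); rewrite addrC addKr.
have hQ : N Q <= N (P + Q) by apply: (norm_mono pQ); rewrite addrK.
lra.
Qed.

Lemma norm_sum_le_symmodmx m (A : 'I_m -> 'M[R[i]]_n) :
  N (\sum_(k < m) A k) <= 2 * N (\sum_(k < m) symmodmx (A k)).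
Proof.
pose P := \sum_(k < m) modmx ((A k) ^t*); pose Q := \sum_(k < m) modmx (A k).
have pB : psdmx (block_mx P (\sum_(k < m) A k) ((\sum_(k < m) A k) ^t*) Q).
  have -> : block_mx P (\sum_(k < m) A k) ((\sum_(k < m) A k) ^t*) Q
    = \sum_(k < m) block_mx (modmx ((A k) ^t*)) (A k) ((A k) ^t*) (modmx (A k)).
    rewrite /P /Q; move: (index_enum _) => r.
    elim: r => [|k r IH]; first by rewrite !big_nil trCmx0 block_mx0.
    by rewrite !big_cons trCmxD -IH add_block_mx.
  by apply: psdmx_sum => k; apply: psdmx_block_modmx.
have pP : psdmx P by apply: psdmx_sum => k; apply: psdmx_modmx.
have pQ : psdmx Q by apply: psdmx_sum => k; apply: psdmx_modmx.
apply: le_trans (norm_offdiag_le_add pP pQ pB) _.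
rewrite -norm_double (_ : _ + _ = P + Q) //.
by rewrite -scaler_sumr -scalerDl half_add_half scale1r big_split addrC.
Qed.
End UnitarilyInvariantNorm.

(** * Matrix units *)

Section MatrixUnits.
Set Implicit Arguments.
Unset Strict Implicit.
Variable C : numClosedFieldType.

Lemma tperm_mx_unitary n (i j : 'I_n) : (tperm_mx i j : 'M[C]_n) \is unitarymx.
Proof.
apply/unitarymxP; rewrite /tperm_mx tr_perm_mx map_perm_mx -perm_mxM.
by rewrite perm.tpermV perm.tperm2 perm_mx1.
Qed.

Lemma unitarymx_entry_le1 n (U : 'M[C]_n) i j : U \is unitarymx -> `|U i j| <= 1.
Proof.
move=> /unitarymxP /matrixP /(_ i i); rewrite !mxE eqxx mulr1n => e.
rewrite -(@expr_le1 _ 2) // -e (bigD1 j) //= !mxE normCK lerDl sumr_ge0 // => k _.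
by rewrite !mxE -normCK exprn_ge0.
Qed.

Lemma modmx0 n : modmx (0 : 'M[C]_n) = 0.
Proof. by apply: modmx_uniq; [exact: psdmx0 | rewrite !mulmx0]. Qed.

Lemma psdmx_delta n (j : 'I_n) : psdmx (delta_mx j j : 'M[C]_n).
Proof.
by have := psdmx_gram (delta_mx j j : 'M[C]_n); rewrite trCmx_delta mul_delta_mx.
Qed.

Lemma modmx_delta n (i j : 'I_n) : modmx (delta_mx i j : 'M[C]_n) = delta_mx j j.
Proof.
apply: modmx_uniq; first exact: psdmx_delta.
by rewrite trCmx_delta !mul_delta_mx.
Qed.

Lemma psdmx_1B_delta n (i j : 'I_n) : i != j ->
  psdmx (1%:M - (delta_mx i i + delta_mx j j) : 'M[C]_n).
Proof.
move=> ij.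
have := @psdmx_diag C n 1%:M (\row_k ((k != i) && (k != j))%:R).
rewrite trCmx1 mul1mx mulmx1 (_ : diag_mx _ = 1%:M - (delta_mx i i + delta_mx j j)).
  by apply=> k; rewrite mxE ler0n.
apply/matrixP => k l; rewrite !mxE; have [<-|kl] := eqVneq k l.
  rewrite !andbb; have [->|_] := eqVneq k i; first by rewrite (negbTE ij) addr0 subrr.
  by case: eqP; rewrite ?add0r ?subrr ?subr0.
have off r : (k == r) && (l == r) = false.
  by apply: contraNF kl => /andP[/eqP -> /eqP ->].
by rewrite !off /= mulr0n addr0 subr0.
Qed.
End MatrixUnits.

(** * The operator norm *)

Section OperatorNorm.
Set Implicit Arguments.
Unset Strict Implicit.
Variables (R : realType) (n : nat) (i0 : 'I_n).
Implicit Types U V Z : 'M[R[i]]_n.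

(** The operator norm is the largest modulus of an inner product of Z between
    unit vectors.  Since a unit vector is a row or a column of some unitary
    matrix, it is also the largest modulus of one fixed entry of U Z V over
    unitary U and V, a form in which unitary invariance is immediate. *)
Definition opnorm_set Z : set R := [set r | exists U V,
  [/\ U \is unitarymx, V \is unitarymx
    & r = Normc.normc ((U *m Z *m V) i0 i0)]]%classic.

Definition opnorm Z : R := sup (opnorm_set Z).

Lemma opnorm_set_nonempty Z : (opnorm_set Z !=set0)%classic.
Proof.
exists (Normc.normc ((1%:M *m Z *m 1%:M) i0 i0)); exists 1%:M, 1%:M.
by split=> //; apply: unitarymx1.
Qed.

Lemma opnorm_le Z x :
  (forall U V, U \is unitarymx -> V \is unitarymx ->
     Normc.normc ((U *m Z *m V) i0 i0) <= x) -> opnorm Z <= x.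
Proof.
move=> h; apply: ge_sup; first exact: opnorm_set_nonempty.
by move=> r [U [V [Uu Vu ->]]]; apply: h.
Qed.

Lemma opnorm_ge U V Z : U \is unitarymx -> V \is unitarymx ->
  Normc.normc ((U *m Z *m V) i0 i0) <= opnorm Z.
Proof.
move=> Uu Vu; apply: ub_le_sup; last by exists U, V.
(* Entries of unitary matrices have modulus at most 1, so the sum of the moduli
   of the entries of Z is a bound. *)
pose B : R[i] := \sum_l \sum_k `|Z k l|.
have Br : B \is Num.real.
  by apply: ger0_real; apply: sumr_ge0 => l _; apply: sumr_ge0.
exists (complex.Re B) => _ [U' [V' [Uu' Vu' ->]]].
rewrite -lecR (RRe_real Br) [X in X <= _](_ : _ = `|(U' *m Z *m V') i0 i0|) //.
rewrite mxE; apply: le_trans (ler_norm_sum _ _ _) _; apply: ler_sum => l _.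
rewrite normrM -[leRHS]mulr1 ler_pM ?unitarymx_entry_le1 //.
rewrite mxE; apply: le_trans (ler_norm_sum _ _ _) _; apply: ler_sum => k _.
rewrite normrM; apply: ler_piMl; first exact: normr_ge0.
exact: (unitarymx_entry_le1 i0 k Uu').
Qed.

Lemma opnorm_entry Z i j : Normc.normc (Z i j) <= opnorm Z.
Proof.
have := opnorm_ge Z (tperm_mx_unitary R[i] i i0) (tperm_mx_unitary R[i] j i0).
by rewrite -xrowE -xcolE !mxE !perm.tpermR.
Qed.

Lemma opnorm_uinorm : unitarily_invariant_norm opnorm.
Proof.
have opge0 Z : 0 <= opnorm Z.
  apply: le_trans (opnorm_entry Z i0 i0).
  by case: (Z i0 i0) => a b; apply: sqrtr_ge0.
have opZ a Z : opnorm (a *: Z) <= Normc.normc a * opnorm Z.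
  apply: opnorm_le => U V Uu Vu; rewrite -scalemxAr -scalemxAl mxE Normc.normcM.
  by rewrite ler_wpM2l ?opnorm_ge //; case: (a) => ? ?; apply: sqrtr_ge0.
have opU U Z V : U \is unitarymx -> V \is unitarymx ->
    opnorm (U *m Z *m V) <= opnorm Z.
  move=> Uu Vu; apply: opnorm_le => U' V' Uu' Vu'.
  have := opnorm_ge Z (mul_unitarymx Uu' Uu) (mul_unitarymx Vu Vu').
  by rewrite !mulmxA.
split; last first.
  move=> U Z V Uu Vu; apply/le_anti/andP; split; first exact: opU.
  have Uu' : U ^t* \is unitarymx by rewrite trmxC_unitary; exact: Uu.
  have Vu' : V ^t* \is unitarymx by rewrite trmxC_unitary; exact: Vu.
  have := opU _ (U *m Z *m V) _ Uu' Vu'.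
  by rewrite !mulmxA (mulmxtVK _ Vu) (unitarymx_trCl Uu) mul1mx.
split=> //.
- move=> Z Z0; apply/matrixP => i j; rewrite mxE; apply: Normc.eq0_normc.
  apply/le_anti; rewrite -{1}Z0 opnorm_entry /=.
  by case: (Z i j) => ? ?; apply: sqrtr_ge0.
- move=> a Z; apply/le_anti; rewrite opZ /=.
  (* The reverse inequality is opZ for the scalar 1/a and the matrix a Z. *)
  have [->|a0] := eqVneq a 0; first by rewrite Normc.normc0 mul0r.
  have na : 0 < Normc.normc a.
    rewrite lt_neqAle; apply/andP; split.
      by rewrite eq_sym; apply: contra_neq a0 => /Normc.eq0_normc.
    by case: (a) => ? ?; apply: sqrtr_ge0.
  have := opZ a^-1 (a *: Z); rewrite scalerA mulVf // scale1r Normc.normcV.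
  by rewrite mulrC ler_pdivlMr // mulrC.
- move=> Y Z; apply: opnorm_le => U V Uu Vu.
  rewrite mulmxDr mulmxDl mxE; apply: le_trans (le_normcD _ _) _.
  by rewrite lerD // opnorm_ge.
Qed.

Lemma opnorm1 : opnorm 1%:M <= 1.
Proof.
apply: opnorm_le => U V Uu Vu; rewrite mulmx1 -lecR.
exact: (unitarymx_entry_le1 _ _ (mul_unitarymx Uu Vu)).
Qed.
End OperatorNorm.

Theorem theorem1p8 (R : realType) (m n : nat)
    (hm : (2 <= m)%N) (hn : (2 <= n)%N) :
  (forall N : 'M[R[i]]_n -> R, unitarily_invariant_norm N ->
     forall A : 'I_m -> 'M[R[i]]_n,
       N (\sum_(k < m) A k) <= 2 * N (\sum_(k < m) symmodmx (A k)))
  /\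
  (forall c : R,
     (forall N : 'M[R[i]]_n -> R, unitarily_invariant_norm N ->
        forall A : 'I_m -> 'M[R[i]]_n,
          N (\sum_(k < m) A k) <= c * N (\sum_(k < m) symmodmx (A k))) ->
     2 <= c).
Proof.
split=> [N hN A | c hc]; first exact: norm_sum_le_symmodmx.
pose a : 'I_n := Ordinal (ltnW hn); pose b : 'I_n := Ordinal hn.
pose k0 : 'I_m := Ordinal (ltnW hm).
have ba : b != a by [].
have hN := opnorm_uinorm R a; have [hax _] := hN.
pose D : 'M[R[i]]_n := delta_mx b b + delta_mx a a.
have := hc _ hN (fun k => if k == k0 then delta_mx a b else 0).
rewrite (bigD1 k0) //= big1 => [|k /negbTE -> //].
rewrite ?eqxx /= addr0 (bigD1 k0) //= big1 => [|k /negbTE ->]; last first.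
  by rewrite /symmodmx trCmx0 modmx0 addr0 scaler0.
rewrite ?eqxx /= addr0 /symmodmx trCmx_delta !modmx_delta -/D => h.
have E1 : 1 <= opnorm a (delta_mx a b : 'M[R[i]]_n).
  have := opnorm_entry a (delta_mx a b : 'M[R[i]]_n) a b.
  by rewrite mxE !eqxx Normc.normc1.
(* E_aa + E_bb is a projection, hence below the identity. *)
have D1 : opnorm a D <= 1.
  apply: le_trans (opnorm1 R a).
  apply: (norm_mono hN); last exact: psdmx_1B_delta.
  by apply: psdmxD; apply: psdmx_delta.
have N2 : 2 * opnorm a (2^-1 *: D) = opnorm a D.
  by rewrite -(norm_double hN) -scalerDl half_add_half scale1r.
have D0 := mxnorm_ge0 hax (2^-1 *: D).
have := le_trans E1 h; move: D1 D0; rewrite -N2.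
move: (opnorm a (2^-1 *: D)) => x x1 x0 cx {E1 h N2 hN hax hc}.
have {x1} x1 : x <= 2^-1 by lra.
rewrite leNgt; apply/negP => c2.
have xgt0 : 0 < x.
  rewrite lt_neqAle x0 andbT eq_sym; apply: contraTneq cx => ->.
  by rewrite mulr0 -ltNge ltr01.
have : c * x < 2 * x by rewrite ltr_pM2r.
lra.
Qed.
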